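(* Fix $\delta\in(0,1)$. For task $t$ with sample size $n_t\ge 2$, let $$\mathcal{L}_t(\theta)=R_t(\theta)+\lambda\,\Delta_t(\theta),\qquad R_t(\theta)=\mathbb{E}_{(x,y)\sim\mathcal{D}_t}\big[\ell_t(f_\theta(x),y)\big],$$ where $\ell_t\in[0,1]$ and $\Delta_t(\theta)=\sum_{\ell=1}^{L}\big(H_\ell(\theta)-H^{*}_{\ell,t}\big)^2$. Let $\hat{\mathcal{L}}_t(\theta)=\hat R_t(\theta)+\lambda\,\hat\Delta_t(\theta)$ be the empirical analogue on $n_t$ samples. For any posterior $q_t$ absolutely continuous with respect to a prior $p_t$ (chosen before seeing the task-$t$ data), with probability at least $1-\delta$ over the sample, $$\mathbb{E}_{\theta\sim q_t}\big[\mathcal{L}_t(\theta)\big]\le \mathbb{E}_{\theta\sim q_t}\big[\hat{\mathcal{L}}_t(\theta)\big]+\sqrt{\frac{\mathrm{KL}(q_t\Vert p_t)+\ln\frac{2\sqrt{n_t}}{\delta}}{2(n_t-1)}}+\lambda\,\mathbb{E}_{\theta\sim q_t}\big[\Delta_t(\theta)\big].$$ Moreover, if $p_t=\mathcal{N}(\theta_{t-1},\Sigma_p)$ and $q_t$ has mean $\bar\theta_t$ and covariance $\Sigma_q$, then $$\mathrm{KL}(q_t\Vert p_t)\le \frac{\kappa_t}{2}\,\|\bar\theta_t-\theta_{t-1}\|^2+C_t,$$ where $$\kappa_t:=\lambda_{\max}(\Sigma_p^{-1}),\qquad C_t:=\tfrac12\Big(\mathrm{tr}(\Sigma_p^{-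1}\Sigma_q)-k+\ln\frac{\det\Sigma_p}{\det\Sigma_q}\Big).$$
   Context: Continual learning setting: tasks arrive sequentially, and task $t$ has a data distribution $\mathcal{D}_t$ over input–label pairs $(x,y)$, from which the sample of size $n_t$ is drawn. A model $f_\theta$ with parameter vector $\theta$ has $L$ layers, each equipped with a classification head that outputs a probability vector over classes. $\ell_t(\cdot,\cdot)$ is the loss function of task $t$ (not to be confused with the layer index $\ell$). $H_\ell(\theta)$ is the output entropy of layer $\ell$, i.e. the (average over inputs) Shannon entropy of the probability vector output by the head of layer $\ell$, and $H^{*}_{\ell,t}$ is the target entropy for layer $\ell$ at task $t$. $\lambda$ is the weight of the entropy regularization term. $\hat R_t$ and $\hat\Delta_t$ are the empirical counterparts of $R_t$ and $\Delta_t$, computed on the $n_t$ samples of task $t$. $p_t$ and $q_t$ are probability distributions over the parameters $\theta$; $k$ is the dimension of $\theta$; $\theta_{t-1}$ is the parameter vector obtained after training on task $t-1$. $\mathrm{KL}$ is the Kullback–Leibler divergence, $\lambda_{\max}$ the largest eigenvalue, $\|\cdot\|$ the Euclidean norm.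
   Formalization: The weight λ is assumed nonnegative (the bound fails for very negative λ), and in the ''moreover'' part q_t is assumed to be the Gaussian N(θ̄_t, Σ_q) with positive definite Σ_q, since the KL bound is false for non-Gaussian q_t (e.g. uniform q_t against a standard normal p_t). *)

(* Defs.v *)
From HB Require Import structures.
From mathcomp Require Import all_boot all_order all_algebra.
From mathcomp Require Import all_classical all_reals all_analysis.

Set Implicit Arguments.
Unset Strict Implicit.
Unset Printing Implicit Defensive.

Import Order.TTheory GRing.Theory Num.Theory.
Import numFieldNormedType.Exports.

Local Open Scope classical_set_scope.
Local Open Scope charge_scope.
Local Open Scope ring_scope.

Section power_measure.
Context d (T : measurableType d) (R : realType).
Variable mu : {sigma_finite_measure set T -> \bar R}.

Definition pair_cons n (w : n.-tuple T * T) : n.+1.-tuple T :=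
  [the n.+1.-tuple T of w.2 :: w.1].

Lemma measurable_pair_cons n : measurable_fun [set: n.-tuple T * T] (@pair_cons n).
Proof. by apply: measurable_cons. Qed.

Definition power_measure_step n (nu : {measure set (n.-tuple T) -> \bar R}) :
    {measure set (n.+1.-tuple T) -> \bar R} :=
  measure_function_pushforward__canonical__measure_function_Measure
    [the measure _ _ of (nu \x mu)%E] (@measurable_pair_cons n).

(* The n-fold product measure, on the product sigma-algebra of n.-tuple T. *)
Fixpoint power_measure n : {measure set (n.-tuple T) -> \bar R} :=
  if n is m.+1 then power_measure_step (power_measure m)
  else [the measure _ _ of \d_([tuple] : 0.-tuple T)].

Lemma power_measure_box n (A : 'I_n -> set T) : (forall i, measurable (A i)) ->
  power_measure n [set t | forall i, A i (tnth t i)] =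
  (\prod_(i < n) mu (A i))%E.
Proof.
elim: n A => [A _|n IH A mA] /=.
  by rewrite big_ord0 diracE mem_set// => -[].
rewrite /measure_function.pushforward.
set B := [set t : n.-tuple T | forall i, A (lift ord0 i) (tnth t i)].
have mB : measurable B.
  have -> : B = \bigcap_(i in [set: 'I_n]) (@tnth n T)^~ i @^-1` A (lift ord0 i).
    by apply/seteqP; split => [t Bt i _|t Bt i]; [exact: Bt|exact: (Bt i)].
  apply: fin_bigcap_measurable => // i _; rewrite -[X in measurable X]setTI.
  exact: measurable_tnth.
have -> : @pair_cons n @^-1` [set t | forall i, A i (tnth t i)] =
    B `*` A ord0.
  apply/seteqP; split => [[t x] /= h|[t x] /= [Bt Ax] i].
    by split => [i|] /=; [have := h (lift ord0 i); rewrite tnthS|exact: (h ord0)].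
  case: (unliftP ord0 i) => [j ->|->]; last exact: Ax.
  by rewrite tnthS; exact: Bt.
rewrite product_measure1E// big_ord_recl muleC; congr (_ * _)%E; exact: IH.
Qed.

End power_measure.

(* The parameter space R^k, with its Borel (= product) sigma-algebra; [pvec]
   reads a parameter as a column vector. *)
Notation params R k := (k.-tuple (measurableTypeR R)).

Definition pvec (R : realType) k (theta : params R k) : 'cV[R]_k :=
  \col_i tnth theta i.

Definition lebesgue_params (R : realType) k :
    {measure set (params R k) -> \bar R} :=
  power_measure (@lebesgue_measure R) k.

(* The norm [`|v|] of the library on matrices is the sup norm. *)
Definition euclid_norm (R : realType) k (v : 'cV[R]_k) : R :=
  Num.sqrt (\sum_i v i ord0 ^+ 2).

Definition quad_form (R : realType) k (A : 'M[R]_k) (v : 'cV[R]_k) : R :=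
  (v^T *m A *m v) ord0 ord0.

Definition sym_posdef (R : realType) k (A : 'M[R]_k) : Prop :=
  A^T = A /\ forall v : 'cV[R]_k, v != 0 -> 0 < quad_form A v.

Definition lambda_max (R : realType) k (A : 'M[R]_k) : R :=
  sup [set a : R | eigenvalue A a].

Section laws_on_params.
Context (R : realType) (k : nat).
Implicit Types (q : probability (params R k) R) (m : 'cV[R]_k) (S : 'M[R]_k).

Definition has_mean q m : Prop := forall i : 'I_k,
  q.-integrable setT (fun theta => (tnth theta i)%:E) /\
  \int[q]_theta tnth theta i = m i ord0.

Definition has_covariance q S : Prop :=
  let c i theta : R := tnth theta i - \int[q]_eta tnth eta i in
  forall i j : 'I_k,
  q.-integrable setT (fun theta => (c i theta * c j theta)%:E) /\
  \int[q]_theta (c i theta * c j theta) = S i j.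

Definition gaussian_pdf m S (theta : params R k) : R :=
  (Num.sqrt ((2 * pi) ^+ k * \det S))^-1 *
  expR (- (quad_form (invmx S) (pvec theta - m) / 2)).

(* q = N(m, S) with S nonsingular. *)
Definition is_gaussian q m S : Prop :=
  sym_posdef S /\
  forall A : set (params R k), measurable A ->
    q A = (\int[lebesgue_params R k]_(theta in A) (gaussian_pdf m S theta)%:E)%E.

End laws_on_params.

Definition KL d (T : measurableType d) (R : realType)
    (q p : probability T R) : \bar R :=
  if `[< q `<< p >] then
    (\int[q]_x (ln (fine ('d (charge_of_finite_measure q) '/d p x)))%:E)%E
  else +oo%E.

(* [ln 0 = 0] in the library, so zero probabilities contribute 0. *)
Definition shannon_entropy (R : realType) (C : finType) (u : C -> R) : R :=
  - \sum_i u i * ln (u i).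

Section objective.
Context dX dY (X : measurableType dX) (Y : measurableType dY) (R : realType).
Context (k L n : nat) (O : Type) (C : finType).
Variables (D : probability (X * Y)%type R) (s : n.-tuple (X * Y)%type).
Variables (f : params R k -> X -> O) (head : 'I_L -> params R k -> X -> C -> R).
Variables (loss : O -> Y -> R) (Hstar : 'I_L -> R) (lambda : R).

Definition risk theta : R := \int[D]_z loss (f theta z.1) z.2.

Definition emp_risk theta : R :=
  n%:R^-1 * \sum_(i < n) loss (f theta (tnth s i).1) (tnth s i).2.

Definition layer_entropy l theta : R :=
  \int[D]_z shannon_entropy (head l theta z.1).

Definition emp_layer_entropy l theta : R :=
  n%:R^-1 * \sum_(i < n) shannon_entropy (head l theta (tnth s i).1).

Definition Delta theta : R :=
  \sum_(l < L) (layer_entropy l theta - Hstar l) ^+ 2.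

Definition emp_Delta theta : R :=
  \sum_(l < L) (emp_layer_entropy l theta - Hstar l) ^+ 2.

Definition objective theta : R := risk theta + lambda * Delta theta.

Definition emp_objective theta : R := emp_risk theta + lambda * emp_Delta theta.

End objective.

(* Main.v *)
(* PAC-Bayes bound. As [lambda >= 0] and the empirical [Delta] is nonnegative,
   only the deviation between risk and empirical risk has to be controlled. By
   Hoeffding's lemma the deviation [x] of a sample mean is sub-Gaussian with
   variance proxy [1 / (4 n)]; writing [expR (c ^+ 2 * x ^+ 2 / 2)] as a Gaussian
   average of [expR (c * x * g)] gives [E (expR (2 (n - 1) x^2)) <= sqrt n].
   Tonelli and Markov's inequality turn this into an event of probability at
   least [1 - delta], on which the Donsker-Varadhan inequality and Jensen's
   inequality yield the bound for every posterior at once.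

   Gaussian case. The density of [q] with respect to [p] is the quotient of the
   two Gaussian densities, its logarithm is a quadratic polynomial, and its mean
   is computed from the first two moments of [q]; the remaining quadratic form
   is bounded by the largest eigenvalue. *)
From HB Require Import structures.
Require Import Defs.
From mathcomp Require Import all_boot all_order all_algebra.
From mathcomp Require Import all_classical all_reals all_analysis.
From mathcomp Require Import measurable_realfun.
From mathcomp Require Import ring lra.

Set Implicit Arguments.
Unset Strict Implicit.
Unset Printing Implicit Defensive.

Import Order.TTheory GRing.Theory Num.Theory.
Import numFieldNormedType.Exports.

Local Open Scope classical_set_scope.
Local Open Scope ring_scope.

(** * Exponential moments of Bernoulli and Gaussian laws *)

Section subgaussian.
Variable R : realType.
Implicit Types m s x : R.

(** The tangent to the exponential at [s * x] lies below the curve at [0] and at [s]; with weights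
    [1 - x] and [x] the two slope terms cancel. *)
Lemma expR_chord_le s x : 0 <= x <= 1 -> expR (s * x) <= 1 - x + x * expR s.
Proof.
move=> /andP[x0 x1].
have h0 : expR (s * x) * (1 - s * x) <= 1.
  rewrite -[leRHS](expRxMexpNx_1 (s * x)) ler_wpM2l ?expR_ge0//.
  by have := expR_ge1Dx (- (s * x)).
have h1 : expR (s * x) * (1 + (s - s * x)) <= expR s.
  rewrite -[X in _ <= expR X](subrKC (s * x)) expRD ler_wpM2l ?expR_ge0//.
  exact: expR_ge1Dx.
have := lerD (ler_wpM2l (_ : 0 <= 1 - x) h0) (ler_wpM2l x0 h1).
rewrite subr_ge0 mulr1 => /(_ x1); apply: le_trans.
by rewrite le_eqVlt; apply/orP; left; apply/eqP; ring.
Qed.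

Let mgf m s : R := 1 - m + m * expR s.

Let mgf_gt0 m s : 0 <= m <= 1 -> 0 < mgf m s.
Proof.
move=> /andP[m0 m1]; rewrite /mgf; have := expR_gt0 s.
by move: (expR s) => e e0; nra.
Qed.

(** The derivative of [ln (mgf m s)] in [s], that is, the mean of the exponentially tilted Bernoulli
    law. Its own derivative is the variance of that law, hence at most [1 / 4]. *)
Let tilt m s : R := m * expR s / mgf m s.

Let is_derive_mgf m s : is_derive s (1 : R) (mgf m) (m * expR s).
Proof.
rewrite /mgf; apply: is_derive_eq.
by rewrite add0r mul1r.
Qed.

Let is_derive_tilt m s : 0 <= m <= 1 ->
  is_derive s (1 : R) (tilt m) (tilt m s * (1 - tilt m s)).
Proof.
move=> m01; have mgf0 : mgf m s != 0 by rewrite gt_eqF// mgf_gt0.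
have d1 := is_derive_mgf m s.
have d2 : is_derive s (1 : R) (fun x => (mgf m x)^-1) (- (mgf m s) ^- 2 *: (m * expR s)).
  exact: is_deriveV.
have d3 : is_derive s (1 : R) (fun x => m * expR x) (m * expR s).
  by apply: is_derive_eq; rewrite ?mul1r ?scaler0 ?addr0 ?add0r.
apply: is_derive_eq.
rewrite /tilt /GRing.scale/=.
by field.
Qed.

Let tilt_le m s : 0 <= m <= 1 -> 0 <= s -> tilt m s - m <= s / 4.
Proof.
move=> m01; rewrite le_eqVlt => /predU1P[<-|s0].
  by rewrite /tilt /mgf expR0 !mulr1 subrK divr1 subrr mul0r.
have [||c _] := @MVT _ (tilt m) (fun x => tilt m x * (1 - tilt m x)) 0 s s0.
- by move=> x _; exact: is_derive_tilt.
- apply: derivable_within_continuous => x _.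
  by have [] := is_derive_tilt x m01.
rewrite {2}/tilt /mgf expR0 !mulr1 subrK divr1 subr0 => ->.
rewrite [leRHS]mulrC ler_wpM2r ?(ltW s0)//.
move: (tilt m c) => u; rewrite -subr_ge0.
have -> : 4^-1 - u * (1 - u) = (u - 2^-1) ^+ 2 by field.
exact: sqr_ge0.
Qed.

(** The gap [F] between the two exponents vanishes at [0], and its derivative [m + x / 4 - tilt m x]
    is nonnegative for [x >= 0] by [tilt_le]. *)
Lemma bernoulli_mgf_le m s : 0 <= m <= 1 ->
  1 - m + m * expR s <= expR (m * s + s ^+ 2 / 8).
Proof.
wlog s0 : m s / 0 <= s => [hw m01|].
  have [s0|/ltW s0] := leP 0 s; first exact: hw.
  (* Exchanging the two Bernoulli outcomes turns [m] into [1 - m] and [s] into [- s], up to a factor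
     [expR s]. *)
  have := hw (1 - m) (- s).
  rewrite oppr_ge0 s0 => /(_ isT).
  have -> : 0 <= 1 - m <= 1 by lra.
  move=> /(_ isT) /(ler_wpM2l (expR_ge0 s)).
  rewrite -expRD sqrrN.
  have -> : s + ((1 - m) * - s + s ^+ 2 / 8) = m * s + s ^+ 2 / 8 by ring.
  apply: le_trans.
  rewrite mulrDr (mulrCA _ (1 - m)) expRxMexpNx_1.
  by rewrite le_eqVlt; apply/orP; left; apply/eqP; ring.
move: s0; rewrite le_eqVlt => /predU1P[<-|s0] m01.
  by rewrite expR0 mulr1 subrK mulr0 add0r expr0n mul0r expR0.
rewrite -[leLHS]lnK ?posrE ?mgf_gt0// ler_expR -subr_ge0.
pose F x := m * x + x ^+ 2 / 8 - ln (mgf m x).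
have dF x : is_derive x (1 : R) F (m + x / 4 - tilt m x).
  have d1 := is_derive_mgf m x.
  have d2 : is_derive x (1 : R) (fun x => ln (mgf m x)) ((mgf m x)^-1 * (m * expR x)).
    by apply: (@is_derive1_comp _ (@ln R) (mgf m)); apply: is_derive1_ln; exact: mgf_gt0.
  rewrite /F; apply: is_derive_eq.
  rewrite /tilt /GRing.scale/=.
  by field; rewrite gt_eqF// mgf_gt0.
have [|c] := @MVT _ F (fun x => m + x / 4 - tilt m x) 0 s s0 (fun x _ => dF x).
  by apply: derivable_within_continuous => x _; have [] := dF x.
rewrite in_itv/= => /andP[c0 cs].
have -> : F 0 = 0.
  by rewrite /F /mgf expR0 mulr1 subrK ln1 mulr0 expr0n mul0r addr0 subrr.
rewrite !subr0 -/(F s) => ->; rewrite mulr_ge0 ?(ltW s0)//.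
by have := tilt_le m01 (ltW c0); lra.
Qed.

(** Completing the square turns the integrand into [expR (x ^+ 2 / 2)] times the normal density of
    mean [x]. *)
Lemma gaussian_mgf x :
  (\int[lebesgue_measure]_g (expR (x * g) * normal_pdf 0 1 g)%:E
    = (expR (x ^+ 2 / 2))%:E)%E.
Proof.
under eq_integral => g _.
  have -> : expR (x * g) * normal_pdf 0 1 g = expR (x ^+ 2 / 2) * normal_pdf x 1 g.
    rewrite !normal_pdfE ?oner_eq0// mulrCA [RHS]mulrCA; congr (_ * _).
    rewrite /normal_fun -!expRD; congr expR.
    by field.
  rewrite EFinM; over.
rewrite integralZl//; last exact: integrable_normal_pdf.
by rewrite integral_normal_pdf mule1.
Qed.

End subgaussian.

(** * Densities and the Kullback-Leibler divergence *)

Section density.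
Context d (T : measurableType d) (R : realType).
Implicit Types (nu mu : {measure set T -> \bar R}) (p q : probability T R).

(** Positive and negative parts are compared separately, so integrability is not assumed; this suits
    log-densities, whose integral may be infinite. *)
Lemma le_integral_measurable mu (f g : T -> \bar R) :
  measurable_fun setT f -> measurable_fun setT g ->
  (forall x, (f x <= g x)%E) -> (\int[mu]_x f x <= \int[mu]_x g x)%E.
Proof.
move=> mf mg fg; rewrite integralE [leRHS]integralE leeB//.
- apply: ge0_le_integral => //; [exact: measurable_funepos..|].
  by move=> x _; apply: (@funepos_le _ _ setT); rewrite ?inE.
- apply: ge0_le_integral => //; [exact: measurable_funeneg..|].
  by move=> x _; apply: (@funeneg_le _ _ setT); rewrite ?inE.
Qed.

(** The density is real-valued and nonnegative at every point, so that its logarithm can be handled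
    pointwise. *)
Definition has_density nu mu (r : T -> R) := [/\ measurable_fun setT r,
  forall x, 0 <= r x &
  forall A, measurable A -> nu A = (\int[mu]_(x in A) (r x)%:E)%E].

Import HBNNSimple.

(** Indicators are covered by the definition of a density, simple functions by linearity, and the
    general case by monotone convergence. *)
Lemma integral_density nu mu (r : T -> R) (f : T -> \bar R) :
  has_density nu mu r -> measurable_fun setT f -> (forall x, (0 <= f x)%E) ->
  (\int[nu]_x f x = \int[mu]_x (f x * (r x)%:E))%E.
Proof.
move=> [mr r0 nuE] mf f0.
have mEr : measurable_fun setT (EFin \o r) by exact/measurable_EFinP.
have indicE_ A : measurable A ->
    (\int[nu]_x (\1_A x)%:E = \int[mu]_x ((\1_A x)%:E * (r x)%:E))%E.
  move=> mA; rewrite integral_indic// setIT nuE// integral_mkcond.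
  apply: eq_integral => x _; rewrite patchE indicE.
  by case: (x \in A); rewrite ?mul1e ?mul0e.
have sfunE (h : {nnsfun T >-> R}) :
    (\int[nu]_x (h x)%:E = \int[mu]_x ((h x)%:E * (r x)%:E))%E.
  have mh y : measurable_fun setT (fun x => (y * \1_(h @^-1` [set y]) x)%:E).
    by apply/measurable_EFinP; exact: measurable_funM.
  under eq_integral do rewrite fimfunE -fsumEFin//.
  rewrite ge0_integral_fsum//; last first.
    by move=> y x _; exact: nnfun_muleindic_ge0.
  under [RHS]eq_integral => x _.
    rewrite fimfunE -fsumEFin// ge0_mule_fsuml => [|y]; last exact: nnfun_muleindic_ge0.
    over.
  rewrite ge0_integral_fsum//; last 2 first.
  - by move=> y; exact: emeasurable_funM.
  - by move=> y x _; rewrite mule_ge0 ?lee_fin//; exact: nnfun_muleindic_ge0.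
  apply: eq_fsbigr => y; rewrite inE => -[t _ <-].
  have ht0 : 0 <= h t by exact: fun_ge0.
  under eq_integral do rewrite EFinM.
  under [RHS]eq_integral do rewrite EFinM -muleA.
  rewrite ge0_integralZl//; last by apply/measurable_EFinP.
  rewrite ge0_integralZl//.
  - by rewrite indicE_.
  - by apply: emeasurable_funM => //; apply/measurable_EFinP.
  - by move=> x _; rewrite mule_ge0 ?lee_fin.
pose h := nnsfun_approx measurableT mf.
have hf x : (h n x)%:E @[n --> \oo] --> f x by exact: cvg_nnsfun_approx.
have nd_h x : {homo (fun n => (h n x)%:E) : n m / (n <= m)%N >-> (n <= m)%E}.
  by move=> a b ab; rewrite lee_fin; exact/lefP/nd_nnsfun_approx.
transitivity (limn (fun n => \int[nu]_x (h n x)%:E)%E).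
  rewrite -monotone_convergence//=.
  - by apply: eq_integral => x _; apply/esym/cvg_lim => //; exact: hf.
  - by move=> n; exact/measurable_EFinP.
  - by move=> n x _; rewrite lee_fin.
under eq_fun do rewrite sfunE.
rewrite -monotone_convergence//=.
- apply: eq_integral => x _; apply/cvg_lim => //.
  by apply: cvgeZr => //; exact: hf.
- by move=> n; apply: emeasurable_funM => //; exact/measurable_EFinP.
- by move=> n x _; rewrite mule_ge0 ?lee_fin.
- by move=> x _ a b ab; rewrite lee_wpmul2r ?lee_fin//; exact: nd_h.
Qed.

Local Open Scope charge_scope.

(** Two densities of [q] agree [p]-almost everywhere, hence [q]-almost everywhere by domination, so
    any of them may replace the Radon-Nikodym derivative. *)
Lemma KL_density p q (r : T -> R) : has_density q p r -> q `<< p ->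
  KL q p = (\int[q]_x (ln (r x))%:E)%E.
Proof.
move=> [mr r0 qE] qp; rewrite /KL asboolT//.
have aeE : ae_eq q setT ('d (charge_of_finite_measure q) '/d p) (EFin \o r).
  apply: (null_dominates_ae_eq _ qp) => //.
  apply: integral_ae_eq => //; first exact: Radon_Nikodym_integrable.
    exact/measurable_EFinP.
  by move=> E _ mE; rewrite -Radon_Nikodym_integral// -qE.
apply: ae_eq_integral => //.
- apply/measurable_EFinP; apply: measurableT_comp => //.
  by apply: measurableT_comp => //; apply: measurable_int; exact: Radon_Nikodym_integrable.
- by apply/measurable_EFinP; apply: measurableT_comp.
- by apply: filterS aeE => x /= + _ => /(_ I) ->.
Qed.

Lemma Radon_Nikodym_density p q : q `<< p -> exists r, has_density q p r.
Proof.
move=> qp; pose f := Radon_Nikodym_SigmaFinite.f q p.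
have f_fin x : f x \is a fin_num by exact: Radon_Nikodym_SigmaFinite.f_fin_num.
have f0 x : (0 <= f x)%E by exact: Radon_Nikodym_SigmaFinite.f_ge0.
exists (fine \o f); split.
- apply: measurableT_comp => //; apply: measurable_int.
  exact: Radon_Nikodym_SigmaFinite.f_integrable.
- by move=> x; exact: fine_ge0.
- move=> A mA; apply: etrans (Radon_Nikodym_SigmaFinite.f_integral qp mA) _.
  by apply: eq_integral => x _; rewrite /= fineK//; exact: f_fin.
Qed.

End density.

(** * Integrals of products over an independent sample *)

Section power_probability.
Context d (T : measurableType d) (R : realType) (P : probability T R).

(* A copy of [power_measure P n] that canonically is a probability. *)
Definition power_probability n : set (n.-tuple T) -> \bar R := power_measure P n.

Arguments power_probability : clear implicits.

HB.instance Definition _ n :=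
  Measure.copy (@power_probability n) (power_measure P n : set _ -> \bar R).

Let power_probability_setT n : power_probability n setT = 1%E.
Proof.
have := power_measure_box P (fun _ : 'I_n => measurableT).
under eq_bigr do rewrite /= probability_setT.
rewrite big1_eq => <-; congr (power_measure _ _ _).
by apply/seteqP; split.
Qed.

HB.instance Definition _ n :=
  Measure_isProbability.Build _ _ _ (@power_probability n) (power_probability_setT n).

(** By induction: the power measure is the pushforward of a product measure under [pair_cons], and
    Tonelli splits off the factor of the head coordinate. *)
Lemma integral_power_probability_prod n (h : T -> R) :
  measurable_fun setT h -> (forall x, 0 <= h x) ->
  (\int[power_probability n]_s (\prod_(i < n) h (tnth s i))%:E =
   (\int[P]_x (h x)%:E) ^+ n)%E.
Proof.
move=> mh h0; have mEh : measurable_fun setT (EFin \o h) by exact/measurable_EFinP.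
elim: n => [|n IH].
  rewrite expe0 -[RHS](@power_probability_setT 0) -[RHS]mul1e -integral_cst//.
  by apply: eq_integral => s _; rewrite big_ord0.
have mprod m : measurable_fun setT
    (fun s : m.-tuple T => (\prod_(i < m) h (tnth s i))%:E).
  apply/measurable_EFinP; apply: measurable_prod => i _.
  by apply: measurableT_comp => //; exact: measurable_tnth.
have prod0 m (s : m.-tuple T) : (0 <= (\prod_(i < m) h (tnth s i))%:E)%E.
  by rewrite lee_fin prodr_ge0.
transitivity (\int[power_probability n \x P]_w
    ((\prod_(i < n) h (tnth w.1 i))%:E * (h w.2)%:E))%E.
  rewrite [LHS](ge0_integral_pushforward (@measurable_pair_cons _ T n))//;
    last exact: mprod.
  apply: eq_integral => -[s x] _ /=.
  rewrite big_ord_recl EFinM muleC; congr (_ * _)%E.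
  by congr EFin; apply: eq_bigr => i _; rewrite tnthS.
rewrite (@fubini_tonelli1 _ _ _ _ _ (power_probability n) P)//=; last 2 first.
- apply: emeasurable_funM.
    exact: (measurableT_comp (mprod n) measurable_fst).
  exact: (measurableT_comp mEh measurable_snd).
- by move=> w; rewrite mule_ge0 ?prod0 ?lee_fin.
under eq_integral => s _.
  rewrite /fubini_F/= ge0_integralZl ?prod0//; last by move=> x _; rewrite lee_fin.
  over.
rewrite ge0_integralZr//; last 3 first.
- exact: mprod.
- by move=> s _; exact: prod0.
- by apply: integral_ge0 => x _; rewrite lee_fin.
by rewrite IH; case: n {IH} => [|n]; rewrite ?expe0 ?mul1e// muleC.
Qed.

End power_probability.

Arguments power_probability {d T R} P n _.

(** * Quadratic forms and the largest eigenvalue *)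

Section lambda_max.
Context (R : realType) (k : nat).
Implicit Types (A B : 'M[R]_k) (v w : 'cV[R]_k).

Lemma quad_formE A v : quad_form A v = \sum_i \sum_j A i j * (v i ord0 * v j ord0).
Proof.
rewrite /quad_form mxE exchange_big/=; apply: eq_bigr => j _.
rewrite mxE big_distrl/=; apply: eq_bigr => i _.
by rewrite !mxE; ring.
Qed.

Lemma euclid_norm_sqr v : euclid_norm v ^+ 2 = \sum_i v i ord0 ^+ 2.
Proof. by rewrite sqr_sqrtr// sumr_ge0// => i _; exact: sqr_ge0. Qed.

Lemma euclid_norm_mulmx v : euclid_norm v ^+ 2 = (v^T *m v) ord0 ord0.
Proof. by rewrite euclid_norm_sqr mxE; apply: eq_bigr => i _; rewrite !mxE expr2. Qed.

Lemma euclid_norm_gt0 v : v != 0 -> 0 < euclid_norm v ^+ 2.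
Proof.
move=> v0; rewrite lt_neqAle sqr_ge0 andbT eq_sym; apply: contra v0.
rewrite euclid_norm_sqr psumr_eq0 => [/allP v0|i _]; last exact: sqr_ge0.
apply/eqP/matrixP => i j; rewrite ord1 mxE; apply/eqP.
by rewrite -sqrf_eq0; have := v0 i; rewrite mem_index_enum => /(_ isT).
Qed.

Lemma quad_form_bound A : exists2 c : R, 0 < c &
  forall v, `|quad_form A v| <= c * euclid_norm v ^+ 2.
Proof.
(* The summand [1] makes the constant positive; the rest comes from bounding each product of two
   coordinates by [euclid_norm v ^+ 2]. *)
exists (1 + \sum_i \sum_j `|A i j|).
  by rewrite ltr_pwDl// sumr_ge0// => i _; rewrite sumr_ge0.
move=> v; rewrite quad_formE mulrDl mul1r.
apply: (@le_trans _ _ ((\sum_i \sum_j `|A i j|) * euclid_norm v ^+ 2)); last first.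
  by rewrite lerDr sqr_ge0.
rewrite mulr_suml (le_trans (ler_norm_sum _ _ _))// ler_sum// => i _.
rewrite mulr_suml (le_trans (ler_norm_sum _ _ _))// ler_sum// => j _.
rewrite normrM ler_wpM2l//.
have ge_coord l : `|v l ord0| ^+ 2 <= euclid_norm v ^+ 2.
  rewrite real_normK ?num_real// euclid_norm_sqr (bigD1 l)//= lerDl sumr_ge0// => m _.
  exact: sqr_ge0.
rewrite normrM; have := ge_coord i; have := ge_coord j.
move: `|v i ord0| `|v j ord0| => x y; have := sqr_ge0 (x - y); nra.
Qed.

(* Cauchy-Schwarz for the form [B] applied to [invmx B *m v] and [v] bounds
   [euclid_norm v ^+ 4] by [quad_form (invmx B) v * quad_form B v]. *)
Lemma psd_unit_coercive B : B^T = B -> (forall v, 0 <= quad_form B v) ->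
  B \in unitmx -> exists2 c : R, 0 < c &
  forall v, c * euclid_norm v ^+ 2 <= quad_form B v.
Proof.
move=> Bs B0 Bu; have [K K0 QK] := quad_form_bound (invmx B).
exists K^-1; first by rewrite invr_gt0.
move=> v; set N := euclid_norm v ^+ 2; set q := quad_form B v.
pose w := invmx B *m v.
have Bis : (invmx B)^T = invmx B by rewrite trmx_inv Bs.
have wB : w^T *m B = v^T by rewrite trmx_mul Bis -mulmxA mulVmx// mulmx1.
have Bw : B *m w = v by rewrite mulmxA mulmxV// mul1mx.
have quadD (t : R) : quad_form B (w - t *: v) =
    quad_form (invmx B) v - 2 * t * N + t ^+ 2 * q.
  have -> : quad_form B (w - t *: v) = ((w^T - t *: v^T) *m B *m (w - t *: v)) ord0 ord0.
    by congr ((_ *m _ *m _) _ _); apply/matrixP => i j; rewrite !mxE.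
  rewrite !(mulmxBl, mulmxBr) -!(scalemxAl, scalemxAr) !wB -(mulmxA _ B w) Bw.
  rewrite /N euclid_norm_mulmx /q /quad_form /w mulmxA !mxE.
  ring.
have N0 : 0 <= N by exact: sqr_ge0.
have p_le : quad_form (invmx B) v <= K * N by exact: le_trans (ler_norm _) (QK v).
rewrite mulrC ler_pdivrMr//.
(* At [t = K] nonnegativity reads [0 <= quad_form (invmx B) v - 2 K N + K^2 q]; since the first term
   is at most [K N], this leaves [K N <= K^2 q]. *)
have := B0 (w - K *: v); rewrite quadD.
have := B0 v; rewrite -/q => q0 h.
have : K * N <= K * (q * K) by nra.
by rewrite ler_pM2l.
Qed.

(** [eigenvalueP] yields a row eigenvector; its transpose is the column vector that [quad_form]
    expects. *)
Lemma eigenvalue_quad_form A a : A^T = A -> eigenvalue A a ->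
  exists2 v, v != 0 & quad_form A v = a * euclid_norm v ^+ 2.
Proof.
move=> As /eigenvalueP[u uA u0]; exists u^T; first by rewrite trmx_eq0.
by rewrite /quad_form trmxK uA -scalemxAl mxE euclid_norm_mulmx trmxK.
Qed.

(** The least [t] for which [t%:M - A] is positive semidefinite must be an eigenvalue: were that
    matrix invertible, it would be coercive and [t] could be lowered. This replaces maximizing the
    form over the compact unit sphere. *)
Lemma quad_form_le_lambda_max A v : A^T = A ->
  quad_form A v <= lambda_max A * euclid_norm v ^+ 2.
Proof.
move=> As; have [->|v0] := eqVneq v 0.
  by rewrite /quad_form mulmx0 mxE euclid_norm_mulmx mulmx0 mxE mulr0.
pose S := [set t : R | forall w, quad_form A w <= t * euclid_norm w ^+ 2].
have [K K0 QK] := quad_form_bound A.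
have SK : S K by move=> w; exact: le_trans (ler_norm _) (QK w).
have S_lb w : w != 0 -> lbound S (quad_form A w / euclid_norm w ^+ 2).
  by move=> w0 t /(_ w); rewrite ler_pdivrMr// euclid_norm_gt0.
have S_inf : has_inf S.
  by split; [exists K|exists (quad_form A v / euclid_norm v ^+ 2); exact: S_lb].
pose t0 := inf S.
have S_t0 : S t0.
  move=> w; have [->|w0] := eqVneq w 0.
    by rewrite /quad_form mulmx0 mxE euclid_norm_mulmx mulmx0 mxE mulr0.
  rewrite -ler_pdivrMr ?euclid_norm_gt0//; apply: lb_le_inf; first by exists K.
  exact: S_lb.
pose B := t0%:M - A.
have quadB w : quad_form B w = t0 * euclid_norm w ^+ 2 - quad_form A w.
  by rewrite /quad_form mulmxBr mulmxBl mul_mx_scalar -scalemxAl !mxE euclid_norm_mulmx !mxE.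
have eig_t0 : eigenvalue A t0.
  have [//|neig] := boolP (eigenvalue A t0); exfalso.
  have Bu : B \in unitmx.
    have -> : B = (-1) *: (A - t0%:M) by rewrite scaleN1r opprB.
    rewrite unitmxZ ?unitrN1// -row_free_unit -kermx_eq0.
    by move: neig; rewrite /eigenvalue negbK.
  have [||//|c c0 Bc] := @psd_unit_coercive B.
  - by rewrite /B linearB/= tr_scalar_mx As.
  - by move=> w; rewrite quadB subr_ge0.
  have : S (t0 - c).
    by move=> w; have := Bc w; rewrite quadB; lra.
  move=> /(ge_inf (proj2 S_inf)); rewrite -/t0; lra.
(* [t0] is an eigenvalue and also bounds all eigenvalues, so the supremum is taken over a bounded
   set and is at least [t0]. *)
apply: (le_trans (S_t0 v)); rewrite ler_wpM2r ?sqr_ge0//.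
apply: ub_le_sup => //; exists t0 => a /= /(eigenvalue_quad_form As)[w w0 Aw].
have := S_t0 w; rewrite Aw ler_pM2r//; exact: euclid_norm_gt0.
Qed.

End lambda_max.

(** * Change of measure from prior to posterior *)

Section donsker_varadhan.
Context d (T : measurableType d) (R : realType).
Implicit Types (p q : probability T R).

Lemma bounded_integrable p (f : T -> R) (M : R) :
  measurable_fun setT f -> (forall x, `|f x| <= M) ->
  p.-integrable setT (EFin \o f).
Proof.
move=> mf fM; apply: measurable_bounded_integrable => //.
  by rewrite [X in (X < _)%E]probability_setT ltry.
exists M; split; first exact: num_real.
by move=> x xM y _ /=; exact: le_trans (fM y) (ltW xM).
Qed.

Lemma integrable_probability_cst p (c : R) : p.-integrable setT (EFin \o cst c).
Proof. exact: (@bounded_integrable p (cst c) `|c|). Qed.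

Lemma integral_probability_cst p (c : R) : (\int[p]_x (EFin \o cst c) x = c%:E)%E.
Proof.
by rewrite [LHS](integral_cst p measurableT c%:E) [X in (_ * X)%E]probability_setT mule1.
Qed.

(** Integrating [1 + u <= expR u] for [u = f - ln Z - ln r] against [q] suffices, because [expR u]
    has [q]-integral at most [1]. The divergence may be infinite. *)
Lemma donsker_varadhan p q (f : T -> R) (M : R) : q `<< p ->
  measurable_fun setT f -> (forall x, `|f x| <= M) ->
  ((\int[q]_x f x)%:E <=
   KL q p + (ln (\int[p]_x expR (f x)))%:E)%E.
Proof.
move=> qp mf fM; have [r rE] := Radon_Nikodym_density qp.
rewrite (KL_density rE qp); have [mr r0 qE] := rE.
have mef : measurable_fun setT (expR \o f) by exact: measurableT_comp.
have ief : p.-integrable setT (EFin \o (expR \o f)).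
  apply: (@bounded_integrable _ _ (expR M)) => // x /=.
  by rewrite ger0_norm ?expR_ge0// ler_expR (le_trans (ler_norm _)).
have iqf := @bounded_integrable q f M mf fM.
set Z := \int[p]_x expR (f x).
have Z0 : 0 < Z.
  apply: (@lt_le_trans _ _ (expR (- M))); first exact: expR_gt0.
  have -> : expR (- M) = \int[p]_x (cst (expR (- M)) x).
    by rewrite Rintegral_cst// [X in fine X]probability_setT mulr1.
  apply: le_Rintegral => //.
    apply: (@bounded_integrable _ _ (expR (- M))) => // x /=.
    by rewrite ger0_norm ?expR_ge0.
  by move=> x _; rewrite ler_expR lerNl (le_trans (ler_norm _))// normrN.
(* [ln 0 = 0 = ln 1], so making [r] positive does not change [ln r]. *)
pose r' x := if r x == 0 then 1 else r x.
have r'0 x : 0 < r' x.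
  by rewrite /r'; case: ifPn => // rx0; rewrite lt_neqAle eq_sym rx0 r0.
have lnr' x : ln (r x) = ln (r' x).
  by rewrite /r'; case: ifPn => // /eqP ->; rewrite ln1 ln0.
have mr' : measurable_fun setT r'.
  apply: measurable_fun_if => //.
  - by apply: (@measurable_fun_eqr _ _ _ _ r (cst 0)).
  - exact: measurable_funTS.
have mlnr : measurable_fun setT (fun x => ln (r x)) by exact: measurableT_comp.
pose W x := expR (f x - ln Z - ln (r x)).
have WE x : W x = Z^-1 * expR (f x) / r' x.
  by rewrite /W lnr' !expRD !expRN !lnK ?posrE// [X in X / _]mulrC.
have mW : measurable_fun setT W.
  apply: measurableT_comp => //; apply: measurable_funB => //.
  exact: measurable_funB.
(* Under [p] the integrand becomes [Z^-1 * expR (f x)] times [r x / r' x]. This last ratio is [0]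
   where [r] vanishes and [1] elsewhere, hence an inequality only. *)
have intW : (\int[q]_x (W x)%:E <= 1)%E.
  rewrite (integral_density rE); last 2 first.
  - exact/measurable_EFinP.
  - by move=> x; rewrite lee_fin expR_ge0.
  have -> : 1%E = (\int[p]_x (Z^-1 * expR (f x))%:E)%E.
    under eq_integral do rewrite EFinM.
    rewrite integralZl// -(fineK (integrable_fin_num _ ief))//.
    by rewrite -EFinM -/Z mulVf ?gt_eqF.
  apply: ge0_le_integral => //.
  - by move=> x _; rewrite mule_ge0 ?lee_fin ?expR_ge0.
  - by apply: emeasurable_funM; exact/measurable_EFinP.
  - by apply/measurable_EFinP; exact: measurable_funM.
  - move=> x _; rewrite lee_fin WE -[leLHS]mulrA.
    rewrite ler_piMr ?mulr_ge0 ?expR_ge0 ?invr_ge0 ?(ltW Z0)//.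
    by rewrite /r'; case: ifPn => [/eqP ->|rx0]; rewrite ?mulr0// mulVf.
have iW : q.-integrable setT (EFin \o W).
  apply/integrableP; split; first exact/measurable_EFinP.
  under eq_integral do rewrite /= ger0_norm ?expR_ge0//.
  exact: le_lt_trans intW (ltry _).
(* [psi] is a [q]-integrable minorant of [ln (r x)], whose own integrability is unknown; linearity
   is applied to [psi] alone. *)
pose psi x := f x - ln Z + 1 - W x.
have psi_le x : psi x <= ln (r x).
  rewrite /psi; have := expR_ge1Dx (f x - ln Z - ln (r x)).
  by rewrite -/(W x); move: (W x) (f x) (ln Z) (ln (r x)) => a b c e; lra.
have int_psi : (\int[q]_x (psi x)%:E =
    (\int[q]_x f x)%:E - (ln Z)%:E + 1 - \int[q]_x (W x)%:E)%E.
  have ic := integrable_probability_cst q.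
  rewrite /psi; under eq_integral do rewrite EFinB EFinD EFinB.
  have i1 : q.-integrable setT (fun x => (f x)%:E - (ln Z)%:E)%E.
    exact: integrableB iqf (ic (ln Z)).
  have i2 : q.-integrable setT (fun x => (f x)%:E - (ln Z)%:E + 1)%E.
    exact: integrableD i1 (ic 1).
  rewrite (integralB measurableT i2 iW) (integralD measurableT i1 (ic 1)).
  rewrite (integralB measurableT iqf (ic (ln Z))).
  rewrite !integral_probability_cst fineK//.
  exact: integrable_fin_num.
have le_int : (\int[q]_x (psi x)%:E <= \int[q]_x (ln (r x))%:E)%E.
  apply: le_integral_measurable => [||x]; rewrite ?lee_fin//; apply/measurable_EFinP => //.
  by do !apply: measurable_funB => //; apply: measurable_funD => //; apply: measurable_funB.
have fW : (\int[q]_x (W x)%:E)%E \is a fin_num by exact: integrable_fin_num.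
rewrite -leeBlDr//; apply: le_trans le_int; rewrite int_psi.
rewrite -(fineK fW) -!(EFinB, EFinD) lee_fin.
have : fine (\int[q]_x (W x)%:E)%E <= 1 by rewrite -lee_fin fineK.
by lra.
Qed.

End donsker_varadhan.

(** * Hoeffding's lemma and the squared deviation of a sample mean *)

Section hoeffding.
Context d (T : measurableType d) (R : realType) (P : probability T R).
Variable X : T -> R.
Hypotheses (mX : measurable_fun setT X) (X01 : forall x, 0 <= X x <= 1).

Let mu := \int[P]_x X x.

Let iX : P.-integrable setT (EFin \o X).
Proof.
apply: (@bounded_integrable _ _ _ _ _ 1) => // x.
by have /andP[x0 x1] := X01 x; rewrite ger0_norm.
Qed.

Let intX : (\int[P]_x (X x)%:E = mu%:E)%E.
Proof. by rewrite fineK//; exact: integrable_fin_num. Qed.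

Lemma Rintegral_unit_interval : 0 <= mu <= 1.
Proof.
rewrite -!lee_fin -intX integral_ge0/=; last first.
  by move=> x _; rewrite lee_fin; have /andP[] := X01 x.
rewrite -(@probability_setT _ _ _ P) -[leRHS]mul1e -integral_cst//.
apply: ge0_le_integral; first exact: measurableT.
- by move=> x _; rewrite lee_fin; have /andP[] := X01 x.
- exact/measurable_EFinP.
- exact: measurable_cst.
- by move=> x _; rewrite lee_fin; have /andP[] := X01 x.
Qed.

(** Averaging the chord bound replaces [X] by a Bernoulli variable with the same mean [mu], to which
    [bernoulli_mgf_le] applies. *)
Lemma hoeffding_mgf s :
  (\int[P]_x (expR (s * (X x - mu)))%:E <= (expR (s ^+ 2 / 8))%:E)%E.
Proof.
have mexp : measurable_fun setT (fun x => expR (s * (X x - mu))).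
  apply: measurableT_comp => //; apply: measurable_funM => //.
  exact: measurable_funB.
apply: (@le_trans _ _ (\int[P]_x
    (expR (- (s * mu)) * (1 + (expR s - 1) * X x))%:E)%E).
  apply: ge0_le_integral; first exact: measurableT.
  - by move=> x _; rewrite lee_fin expR_ge0.
  - exact/measurable_EFinP.
  - apply/measurable_EFinP; apply: measurable_funM => //.
    by apply: measurable_funD => //; exact: measurable_funM.
  - move=> x _; rewrite lee_fin mulrBr addrC expRD ler_wpM2l ?expR_ge0//.
    apply: (le_trans (expR_chord_le s (X01 x))).
    by rewrite le_eqVlt; apply/orP; left; apply/eqP; ring.
under eq_integral do rewrite EFinM EFinD EFinM.
have i1 : P.-integrable setT (fun x => (expR s - 1)%:E * (X x)%:E)%E.
  exact: integrableZl.
have ic := integrable_probability_cst P 1.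
rewrite integralZl//; last exact: integrableD.
rewrite integralD// integralZl// intX [X in (X + _)%E](integral_probability_cst P 1).
rewrite -!(EFinM, EFinD) lee_fin.
have -> : expR (s ^+ 2 / 8) = expR (- (s * mu)) * expR (mu * s + s ^+ 2 / 8).
  by rewrite -expRD; congr expR; ring.
rewrite ler_wpM2l ?expR_ge0//; apply: le_trans (bernoulli_mgf_le s Rintegral_unit_interval).
by rewrite le_eqVlt; apply/orP; left; apply/eqP; ring.
Qed.

(* The square in the exponent is linearized by [gaussian_mgf], so that the
   product structure of the sample can be used under the Gaussian integral. *)
Lemma sample_mean_exp_sqr n : (0 < n)%N ->
  (\int[power_probability P n]_s
     (expR (2 * (n%:R - 1) * (mu - n%:R^-1 * \sum_(i < n) X (tnth s i)) ^+ 2))%:E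
   <= (Num.sqrt n%:R)%:E)%E.
Proof.
move=> n_gt0; have n0 : n%:R != 0 :> R by rewrite pnatr_eq0 -lt0n.
have n1 : 0 <= n%:R - 1 :> R by rewrite subr_ge0 ler1n.
pose dev (s : n.-tuple T) := mu - n%:R^-1 * \sum_(i < n) X (tnth s i).
(* Chosen so that [(c * x) ^+ 2 / 2 = 2 * (n - 1) * x ^+ 2]. *)
pose c : R := Num.sqrt (4 * (n%:R - 1)).
have c2 : c ^+ 2 = 4 * (n%:R - 1) by rewrite sqr_sqrtr// mulr_ge0.
have mdev : measurable_fun setT dev.
  apply: measurable_funB => //; apply: measurable_funM => //.
  apply: measurable_sum => i; apply: measurableT_comp => //.
  exact: measurable_tnth.
have mpdf : measurable_fun setT (@normal_pdf R 0 1) by exact: measurable_normal_pdf.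
under eq_integral => s _.
  rewrite -/(dev s).
  have -> : 2 * (n%:R - 1) * dev s ^+ 2 = (c * dev s) ^+ 2 / 2.
    by rewrite exprMn c2; field.
  rewrite -gaussian_mgf.
  over.
pose K (w : n.-tuple T * R) : \bar R := (expR (c * dev w.1 * w.2) * normal_pdf 0 1 w.2)%:E.
have K0 w : (0 <= K w)%E by rewrite lee_fin mulr_ge0 ?expR_ge0 ?normal_pdf_ge0.
have mK : measurable_fun setT K.
  apply/measurable_EFinP; apply: measurable_funM; last first.
    exact: (measurableT_comp mpdf measurable_snd).
  apply: measurableT_comp => //; apply: measurable_funM => //.
  by apply: measurable_funM => //; exact: (measurableT_comp mdev measurable_fst).
rewrite (@fubini_tonelli _ _ _ _ _ (power_probability P n) lebesgue_measure K mK K0)/=.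
have sqn0 : Num.sqrt n%:R != 0 :> R by rewrite sqrtr_eq0 -ltNge ltr0n.
(* For fixed [g] the sample average is at most [expR ((n - 1) * g ^+ 2 / (2 * n))]. Times the
   standard normal density this leaves [expR (- g ^+ 2 / (2 * n))] over [sqrt (2 * pi)], which is
   [sqrt n] times the normal density of standard deviation [sqrt n]. *)
apply: (@le_trans _ _ (\int[lebesgue_measure]_g
    ((Num.sqrt n%:R)%:E * (normal_pdf 0 (Num.sqrt n%:R) g)%:E))%E); last first.
  rewrite integralZl//; last exact: integrable_normal_pdf.
  by rewrite integral_normal_pdf mule1.
have mexp g : measurable_fun setT (fun s => expR (c * dev s * g)).
  apply: measurableT_comp => //; apply: measurable_funM => //.
  exact: measurable_funM.
apply: ge0_le_integral; first exact: measurableT.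
- move=> g _; apply: integral_ge0 => s _.
  by rewrite lee_fin mulr_ge0 ?expR_ge0 ?normal_pdf_ge0.
- exact: (measurable_fun_fubini_tonelli_G (m1 := power_probability P n) K mK K0).
- by apply/measurable_EFinP; apply: measurable_funM => //; exact: measurable_normal_pdf.
move=> g _; under eq_integral do rewrite /K/= EFinM.
rewrite ge0_integralZr//; last 2 first.
- exact/measurable_EFinP.
- by rewrite lee_fin normal_pdf_ge0.
pose t := - (c * g / n%:R).
under eq_integral => s _.
  have -> : expR (c * dev s * g) = \prod_(i < n) expR (t * (X (tnth s i) - mu)).
    rewrite -expR_sum; congr expR.
    rewrite -mulr_sumr big_split/= sumr_const card_ord /dev /t -mulr_natr.
    by move: (\sum_(i < n) _) => S; field.
  over.
rewrite (integral_power_probability_prod P n (h := fun x => expR (t * (X x - mu)))); last 2 first.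
- apply: measurableT_comp => //; apply: measurable_funM => //.
  exact: measurable_funB.
- by move=> x; exact: expR_ge0.
have := hoeffding_mgf t.
have : (0 <= \int[P]_x (expR (t * (X x - mu)))%:E)%E.
  by apply: integral_ge0 => x _; rewrite lee_fin expR_ge0.
case: (integral _ _ _) => // J; rewrite !lee_fin => J0 JE.
rewrite -EFin_expe -!EFinM lee_fin.
apply: (@le_trans _ _ (expR (t ^+ 2 / 8) ^+ n * normal_pdf 0 1 g)).
  by rewrite ler_wpM2r ?normal_pdf_ge0// lerXn2r ?nnegrE ?expR_ge0.
rewrite -expRM_natl !normal_pdfE ?oner_eq0// /normal_peak /normal_fun sqr_sqrtr//.
rewrite expr1n mul1r subr0 -mulrnAr sqrtrM ?ler0n// invfM -[X in _ <= _ * X]mulrA mulVKf//.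
rewrite mulrCA -expRD le_eqVlt; apply/orP; left; apply/eqP; congr (_ * expR _).
have -> : t ^+ 2 = 4 * (n%:R - 1) * g ^+ 2 / n%:R ^+ 2.
  by rewrite sqrrN exprMn exprVn exprMn c2.
by field.
Qed.

End hoeffding.

(** * The divergence between two Gaussian laws *)

Section gaussian_KL.
Context (R : realType) (k : nat).
Implicit Types (p q : probability (params R k) R) (m : 'cV[R]_k) (S : 'M[R]_k).

Lemma sym_posdef_unitmx S : sym_posdef S -> S \in unitmx.
Proof.
move=> [_ S0]; rewrite -row_free_unit -kermx_eq0; apply/negPn/negP => /rowV0Pn[u].
move=> /sub_kermxP uS u0; have := S0 u^T; rewrite trmx_eq0 => /(_ u0).
by rewrite /quad_form trmxK uS mul0mx mxE ltxx.
Qed.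

Lemma measurable_quad_form (A : 'M[R]_k) m :
  measurable_fun [set: params R k] (fun theta => quad_form A (pvec theta - m)).
Proof.
under eq_fun do rewrite quad_formE.
apply: measurable_sum => i; apply: measurable_sum => j.
apply: measurable_funM => //; under eq_fun do rewrite !mxE.
by apply: measurable_funM; apply: measurable_funB => //; exact: measurable_tnth.
Qed.

Lemma measurable_gaussian_pdf m S : measurable_fun setT (gaussian_pdf m S).
Proof.
apply: measurable_funM => //; apply: measurableT_comp => //.
apply: measurable_funN; apply: measurable_funM => //.
exact: measurable_quad_form.
Qed.

Lemma gaussian_pdf_ge0 m S theta : 0 <= gaussian_pdf m S theta.
Proof. by rewrite mulr_ge0 ?expR_ge0// invr_ge0 sqrtr_ge0. Qed.

Lemma gaussian_has_density q m S : is_gaussian q m S ->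
  has_density q (lebesgue_params R k) (gaussian_pdf m S).
Proof.
move=> [_ qE]; split=> //; first exact: measurable_gaussian_pdf.
exact: gaussian_pdf_ge0.
Qed.

(* If [\det S <= 0], [Num.sqrt] and the inverse send the normalizing constant
   to [0], so the density vanishes and cannot have mass [1]. *)
Lemma is_gaussian_det_gt0 q m S : is_gaussian q m S -> 0 < \det S.
Proof.
move=> [_ qE]; rewrite ltNge; apply/negP => dS0.
have := qE setT measurableT.
rewrite [X in X = _]probability_setT integral0_eq => [[/eqP]|theta _].
  by rewrite oner_eq0.
rewrite /gaussian_pdf ler0_sqrtr ?invr0 ?mul0r//.
by rewrite mulr_ge0_le0// exprn_ge0// mulr_ge0// pi_ge0.
Qed.

Lemma gaussian_pdf_gt0 m S theta : 0 < \det S -> 0 < gaussian_pdf m S theta.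
Proof.
move=> S0; rewrite mulr_gt0 ?expR_gt0// invr_gt0 sqrtr_gt0 mulr_gt0//.
by rewrite exprn_gt0// mulr_gt0// pi_gt0.
Qed.

Lemma ln_gaussian_pdf m S theta : 0 < \det S -> ln (gaussian_pdf m S theta) =
  - (k%:R * ln (2 * pi) + ln (\det S)) / 2 - quad_form (invmx S) (pvec theta - m) / 2.
Proof.
move=> S0; have pi0 : 0 < 2 * pi :> R by rewrite mulr_gt0// pi_gt0.
have c0 : 0 < (2 * pi) ^+ k * \det S by rewrite mulr_gt0// exprn_gt0.
rewrite /gaussian_pdf [LHS]lnM ?posrE ?expR_gt0 ?invr_gt0 ?sqrtr_gt0//.
rewrite expRK lnV ?posrE ?sqrtr_gt0// mulNr; congr (- _ - _).
have -> : k%:R * ln (2 * pi) + ln (\det S) = ln ((2 * pi) ^+ k * \det S).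
  by rewrite [RHS]lnM ?posrE ?exprn_gt0// lnXn// mulr_natl.
rewrite -[X in _ = ln X / _](sqr_sqrtr (ltW c0)) lnXn ?sqrtr_gt0//.
by move: (ln (Num.sqrt _)) => a; field.
Qed.

(** The quotient of the two densities is written as the exponential of a difference, so that it is
    visibly positive and its logarithm simplifies by [expRK]. *)
Lemma gaussian_ratio_density p q mp Sp mq Sq :
  is_gaussian p mp Sp -> is_gaussian q mq Sq ->
  has_density q p (fun theta =>
    expR (ln (gaussian_pdf mq Sq theta) - ln (gaussian_pdf mp Sp theta))).
Proof.
move=> pG qG; have [mgp gp0 pE] := gaussian_has_density pG.
have [mgq gq0 qE] := gaussian_has_density qG.
have dp := is_gaussian_det_gt0 pG; have dq := is_gaussian_det_gt0 qG.
have mr : measurable_fun setT (fun theta =>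
    expR (ln (gaussian_pdf mq Sq theta) - ln (gaussian_pdf mp Sp theta))).
  by apply: measurableT_comp => //; apply: measurable_funB; exact: measurableT_comp.
split => [//|theta|A mA]; first exact: expR_ge0.
rewrite qE// [RHS]integral_mkcond (integral_density (gaussian_has_density pG)).
- rewrite integral_mkcond; apply: eq_integral => theta _; rewrite !patchE.
  case: ifP => _; rewrite ?mul0e// -EFinM expRD expRN !lnK ?posrE ?gaussian_pdf_gt0//.
  by rewrite mulfVK// gt_eqF// gaussian_pdf_gt0.
- by apply/(measurable_restrictT _ mA)/measurable_EFinP; exact: measurable_funTS.
- by move=> theta; rewrite patchE; case: ifP => // _; rewrite lee_fin expR_ge0.
Qed.

(** Writing [theta - m] as the centered part [c] plus the offset [b], the mixed terms integrate to
    zero and the terms quadratic in [c] give the trace. *)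
Lemma integral_quad_form q mu m S (A : 'M[R]_k) : has_mean q mu -> has_covariance q S ->
  q.-integrable setT (fun theta => (quad_form A (pvec theta - m))%:E) /\
  (\int[q]_theta (quad_form A (pvec theta - m))%:E =
    (\tr (A *m S) + quad_form A (mu - m))%:E)%E.
Proof.
move=> qm qS.
pose c i (theta : params R k) : R := tnth theta i - mu i ord0.
have ic1 := integrable_probability_cst q.
have intc := integral_probability_cst q.
have ic i : q.-integrable setT (fun theta => (c i theta)%:E).
  by have [i1 _] := qm i; exact: integrableB i1 (ic1 _).
have cE i : (\int[q]_theta (c i theta)%:E = 0)%E.
  have [i1 mE] := qm i; under eq_integral do rewrite EFinB.
  rewrite (integralB measurableT i1 (ic1 (mu i ord0))) intc -mE fineK ?subee//;
    exact: integrable_fin_num.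
have ccov i j : q.-integrable setT (fun theta => (c i theta * c j theta)%:E) /\
    (\int[q]_theta (c i theta * c j theta)%:E = (S i j)%:E)%E.
  have [] := qS i j; rewrite (proj2 (qm i)) (proj2 (qm j)) => iij <-; split => //.
  by rewrite fineK//; exact: integrable_fin_num.
pose b i := mu i ord0 - m i ord0.
pose h i j theta : \bar R := (A i j * (c i theta * c j theta)
  + (A i j * b j * c i theta + A i j * b i * c j theta) + A i j * (b i * b j))%:E.
have qfE theta : (quad_form A (pvec theta - m))%:E = (\sum_i \sum_j h i j theta)%E.
  rewrite quad_formE -sumEFin; apply: eq_bigr => i _.
  rewrite -sumEFin; apply: eq_bigr => j _.
  by rewrite /h /c /b !mxE; congr EFin; ring.
have hE i j : q.-integrable setT (h i j) /\
    (\int[q]_theta h i j theta = (A i j * S i j + A i j * (b i * b j))%:E)%E.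
  have [iij Eij] := ccov i j.
  have i1 : q.-integrable setT (fun theta => (A i j)%:E * (c i theta * c j theta)%:E)%E.
    exact: integrableZl.
  have i2 : q.-integrable setT (fun theta => (A i j * b j)%:E * (c i theta)%:E)%E.
    exact: integrableZl.
  have i3 : q.-integrable setT (fun theta => (A i j * b i)%:E * (c j theta)%:E)%E.
    exact: integrableZl.
  have i23 := integrableD measurableT i2 i3.
  have i123 := integrableD measurableT i1 i23.
  split; first exact: integrableD i123 (ic1 _).
  transitivity (\int[q]_theta ((A i j)%:E * (c i theta * c j theta)%:E +
      ((A i j * b j)%:E * (c i theta)%:E + (A i j * b i)%:E * (c j theta)%:E) +
      (A i j * (b i * b j))%:E))%E.
    by apply: eq_integral => theta _; rewrite -!(EFinM, EFinD).
  rewrite (integralD measurableT i123 (ic1 (A i j * (b i * b j)))) intc.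
  rewrite (integralD measurableT i1 i23) (integralD measurableT i2 i3).
  by rewrite !integralZl// !cE Eij !mule0 !adde0 -EFinM -EFinD.
have ih i : q.-integrable setT (fun theta => \sum_j h i j theta)%E.
  by apply: integrable_sum => // j _; exact: (hE i j).1.
split.
  apply: (eq_integrable measurableT (fun theta => \sum_i \sum_j h i j theta)%E).
    by move=> theta _; rewrite qfE.
  by apply: integrable_sum => // i _; exact: ih.
under eq_integral do rewrite qfE.
rewrite integral_sum//.
under eq_bigr => i _.
  rewrite integral_sum//; last by move=> j; exact: (hE i j).1.
  under eq_bigr do rewrite (hE _ _).2.
  rewrite sumEFin big_split/=.
  over.
rewrite sumEFin big_split/=; congr (_ + _)%:E.
  apply: eq_bigr => i _; rewrite mxE; apply: eq_bigr => j _; congr (_ * _).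
  (* The trace produces [S j i] in place of [S i j]; both are the integral of the same product. *)
  apply: EFin_inj; rewrite -(ccov i j).2 -(ccov j i).2.
  by apply: eq_integral => theta _; rewrite mulrC.
rewrite quad_formE; apply: eq_bigr => i _; apply: eq_bigr => j _.
by rewrite !mxE.
Qed.

Lemma gaussian_KL p q mp Sp mq Sq : q `<< p ->
  is_gaussian p mp Sp -> is_gaussian q mq Sq ->
  has_mean q mq -> has_covariance q Sq ->
  KL q p = (2^-1 * (\tr (invmx Sp *m Sq) - k%:R + quad_form (invmx Sp) (mq - mp)
    + ln (\det Sp / \det Sq)))%:E.
Proof.
move=> qp pG qG qm qS; rewrite (KL_density (gaussian_ratio_density pG qG) qp).
have dp := is_gaussian_det_gt0 pG; have dq := is_gaussian_det_gt0 qG.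
have [iQp EQp] := integral_quad_form mp (invmx Sp) qm qS.
have [iQq EQq] := integral_quad_form mq (invmx Sq) qm qS.
pose e : R := (ln (\det Sp) - ln (\det Sq)) / 2.
transitivity (\int[q]_theta (e%:E + ((2^-1)%:E * (quad_form (invmx Sp) (pvec theta - mp))%:E
    - (2^-1)%:E * (quad_form (invmx Sq) (pvec theta - mq))%:E)))%E.
  apply: eq_integral => theta _; rewrite expRK !ln_gaussian_pdf// -!(EFinM, EFinB, EFinD).
  by congr EFin; rewrite /e; field.
have i1 : q.-integrable setT
    (fun theta => (2^-1)%:E * (quad_form (invmx Sp) (pvec theta - mp))%:E)%E.
  exact: integrableZl.
have i2 : q.-integrable setT
    (fun theta => (2^-1)%:E * (quad_form (invmx Sq) (pvec theta - mq))%:E)%E.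
  exact: integrableZl.
have ie := integrable_probability_cst q e.
rewrite (integralD measurableT ie (integrableB measurableT i1 i2)).
rewrite (integralB measurableT i1 i2) !integralZl// EQp EQq.
rewrite [X in (X + _)%E](integral_probability_cst q e).
(* The form of [q] around its own mean averages to the trace of the identity, which is [k]. *)
rewrite mulVmx ?sym_posdef_unitmx//; last exact: qG.1.
rewrite mxtrace1 subrr /quad_form mulmx0 [(0 : 'M[R]_1) _ _]mxE addr0.
rewrite -!(EFinM, EFinB, EFinD) ln_div ?posrE//; congr EFin.
by rewrite /e; field.
Qed.

End gaussian_KL.

(** * The PAC-Bayes bound for losses in the unit interval *)

Section pac_bayes.
Context d1 d2 (T : measurableType d1) (Theta : measurableType d2) (R : realType).

Lemma measurable_Rintegral_param (P : probability T R) (g : Theta * T -> R) :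
  measurable_fun setT g -> (forall w, 0 <= g w) ->
  measurable_fun setT (fun theta => \int[P]_z g (theta, z)).
Proof.
move=> mg g0; apply: (measurableT_comp (f := fine)) => //.
apply: (measurable_fun_fubini_tonelli_F (m2 := P) (EFin \o g)).
  exact/measurable_EFinP.
by move=> w; rewrite lee_fin.
Qed.

(** The event is defined through the prior alone and precedes the quantifier over [q], so that the
    posterior may be chosen after the sample is seen. *)
Lemma pac_bayes (P : probability T R) (p : probability Theta R)
    (g : Theta * T -> R) n (delta : R) :
  measurable_fun setT g -> (forall w, 0 <= g w <= 1) -> (1 < n)%N -> 0 < delta < 1 ->
  exists E : set (n.-tuple T),
    [/\ measurable E, ((1 - delta)%:E <= power_measure P n E)%E &
     forall s, E s -> forall q : probability Theta R, q `<< p ->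
     (\int[q]_theta (\int[P]_z g (theta, z))%:E <=
      \int[q]_theta (n%:R^-1 * \sum_(i < n) g (theta, tnth s i))%:E +
      sqrte ((KL q p + (ln (2 * Num.sqrt n%:R / delta))%:E)
             * ((2 * (n%:R - 1))^-1)%:E))%E].
Proof.
move=> mg g01 n1 /andP[d0 _].
have n0 : 0 < n%:R :> R by rewrite ltr0n ltnW.
have sn0 : 0 < Num.sqrt n%:R :> R by rewrite sqrtr_gt0.
pose a : R := 2 * (n%:R - 1).
have a0 : 0 < a by rewrite mulr_gt0// subr_gt0 ltr1n.
pose risk theta : R := \int[P]_z g (theta, z).
pose emp (s : n.-tuple T) theta : R := n%:R^-1 * \sum_(i < n) g (theta, tnth s i).
have g0 w : 0 <= g w by have /andP[] := g01 w.
have mrisk : measurable_fun setT risk by exact: measurable_Rintegral_param.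
have mgtheta theta : measurable_fun setT (fun z => g (theta, z)).
  by apply: measurableT_comp => //; exact: measurable_pair1.
have memp : measurable_fun setT (fun w : n.-tuple T * Theta => emp w.1 w.2).
  apply: measurable_funM => //; apply: measurable_sum => i.
  apply: (measurableT_comp mg); apply/measurable_fun_pairP; split => /=.
    exact: measurable_snd.
  exact: (measurableT_comp (measurable_tnth i) measurable_fst).
have memps s : measurable_fun setT (emp s).
  exact: (measurableT_comp memp (measurable_pair1 s)).
have risk01 theta : 0 <= risk theta <= 1.
  exact: (Rintegral_unit_interval P (mgtheta theta)).
have emp01 s theta : 0 <= emp s theta <= 1.
  apply/andP; split.
    by rewrite mulr_ge0 ?invr_ge0 ?(ltW n0)// sumr_ge0.
  rewrite /emp mulrC ler_pdivrMr// mul1r.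
  apply: (@le_trans _ _ (\sum_(i < n) 1)); last by rewrite sumr_const card_ord.
  by apply: ler_sum => i _; have /andP[] := g01 (theta, tnth s i).
pose dev (s : n.-tuple T) theta := risk theta - emp s theta.
have dev1 s theta : `|dev s theta| <= 1.
  by have /andP[? ?] := risk01 theta; have /andP[? ?] := emp01 s theta; rewrite ler_norml /dev; lra.
have mdevs s : measurable_fun setT (dev s) by exact: measurable_funB.
pose U (w : n.-tuple T * Theta) : \bar R := (expR (a * dev w.1 w.2 ^+ 2))%:E.
have U0 w : (0 <= U w)%E by rewrite lee_fin expR_ge0.
have mU : measurable_fun setT U.
  apply/measurable_EFinP; apply: measurableT_comp => //; apply: measurable_funM => //.
  apply: measurable_funX; apply: measurable_funB => //.
  exact: (measurableT_comp mrisk measurable_snd).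
pose Z := fubini_F p U.
have mZ : measurable_fun setT Z by exact: measurable_fun_fubini_tonelli_F.
have Z0 s : (0 <= Z s)%E by exact: integral_ge0.
have intZ : (\int[power_probability P n]_s Z s <= (Num.sqrt n%:R)%:E)%E.
  rewrite /Z /fubini_F (@fubini_tonelli _ _ _ _ _ (power_probability P n) p U mU U0).
  have -> : (Num.sqrt n%:R)%:E = (\int[p]_theta cst (Num.sqrt n%:R)%:E theta)%E.
    by rewrite integral_cst// [X in (_ * X)%E]probability_setT mule1.
  apply: ge0_le_integral => //.
  - by move=> theta _; exact: integral_ge0.
  - exact: (measurable_fun_fubini_tonelli_G (m1 := power_probability P n)).
  - move=> theta _; apply: (@sample_mean_exp_sqr _ _ _ P (fun z => g (theta, z))) => //.
    exact: ltnW.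
(* Markov's inequality at level [b] bounds the probability of the complement of [E] by [delta / 2],
   hence by [delta]. *)
pose b : R := 2 * Num.sqrt n%:R / delta.
have b0 : 0 < b by rewrite divr_gt0// mulr_gt0.
pose E := [set s | (Z s <= b%:E)%E].
have mE : measurable E.
  by rewrite -[E]setTI; exact: emeasurable_fun_infty_c.
exists E; split => //.
  rewrite -[power_measure P n E]/(power_probability P n E).
  rewrite -[E]setCK probability_setC; last exact: measurableC.
  rewrite EFinB; apply: leeB => //.
  have bad_le : (b%:E * power_probability P n (~` E) <= (Num.sqrt n%:R)%:E)%E.
    apply: le_trans intZ.
    under eq_integral => s _ do rewrite -(gee0_abs (Z0 s)).
    apply: le_trans (le_integral_abse _ measurableT mZ b0).
    rewrite lee_wpmul2l ?lee_fin ?(ltW b0)// le_measure ?inE//.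
    - exact: measurableC.
    - by apply: emeasurable_fun_c_infty => //; exact: measurableT_comp.
    - move=> s /= /negP; rewrite -ltNge => bZ; split => //.
      by rewrite gee0_abs// ltW.
  change (power_probability P n (~` E) <= delta%:E)%E.
  have fin_bad : power_probability P n (~` E) \is a fin_num.
    by apply: fin_num_measure; exact: measurableC.
  move: bad_le; rewrite -(fineK fin_bad) -EFinM !lee_fin => bx.
  rewrite -(ler_pM2l b0); apply: le_trans bx _.
  by rewrite /b divfK ?gt_eqF//; lra.
move=> s Es q qp.
have iq (h : Theta -> R) : measurable_fun setT h -> (forall theta, `|h theta| <= 1) ->
    q.-integrable setT (EFin \o h).
  by move=> mh h1; exact: (@bounded_integrable _ _ _ q h 1).
have idev : q.-integrable setT (EFin \o dev s) by exact: iq.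
pose m : R := \int[q]_theta dev s theta.
have mdev2 : measurable_fun setT (fun theta => a * dev s theta ^+ 2).
  by apply: measurable_funM => //; exact: measurable_funX.
have bnd theta : `|a * dev s theta ^+ 2| <= a.
  rewrite ger0_norm; last by rewrite mulr_ge0 ?sqr_ge0// ltW.
  by rewrite ler_piMr ?(ltW a0)// -real_normK ?num_real// exprn_ile1.
(* Jensen's inequality for the square, obtained by integrating [0 <= a * (dev s theta - m) ^+ 2]. *)
have am : a * m ^+ 2 <= \int[q]_theta (a * dev s theta ^+ 2).
  have ic := integrable_probability_cst q.
  have iadev : q.-integrable setT (EFin \o (fun theta => 2 * a * m * dev s theta)).
    exact: (integrableZl measurableT (2 * a * m) idev).
  have -> : a * m ^+ 2 = \int[q]_theta (2 * a * m * dev s theta - cst (a * m ^+ 2) theta).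
    rewrite (RintegralB measurableT iadev (ic (a * m ^+ 2))).
    rewrite RintegralZl// Rintegral_cst// [X in fine X]probability_setT/= -/m.
    by ring.
  apply: le_Rintegral => //.
  - exact: integrableB iadev (ic _).
  - exact: (@bounded_integrable _ _ _ q _ a).
  move=> theta _ /=; rewrite -subr_ge0.
  have -> : a * dev s theta ^+ 2 - (2 * a * m * dev s theta - a * m ^+ 2)
      = a * (dev s theta - m) ^+ 2 by ring.
  by rewrite mulr_ge0 ?sqr_ge0// ltW.
have Wge : ((a * m ^+ 2)%:E <= KL q p + (ln b)%:E)%E.
  apply: (@le_trans _ _ (\int[q]_theta (a * dev s theta ^+ 2))%:E); first by rewrite lee_fin.
  apply: le_trans (donsker_varadhan qp mdev2 bnd) _; rewrite leeD2l// lee_fin.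
  have Zs : (\int[p]_theta expR (a * dev s theta ^+ 2))%:E = Z s.
    rewrite fineK//; apply: integrable_fin_num => //.
    apply: (@bounded_integrable _ _ _ p _ (expR a)) => [|theta].
      exact: measurableT_comp.
    by rewrite ger0_norm ?expR_ge0// ler_expR (le_trans (ler_norm _)).
  rewrite ler_ln ?posrE//; first by rewrite -lee_fin Zs.
  rewrite -lte_fin Zs.
  (* The exponent is nonnegative, so [Z s] is at least [1] and its logarithm is monotone there. *)
  apply: (@lt_le_trans _ _ 1%E) => //.
  rewrite -(@probability_setT _ _ _ p) -[leLHS]mul1e -integral_cst//.
  apply: ge0_le_integral => //.
  - exact: (measurableT_comp mU (measurable_pair1 s)).
  - by move=> theta _; rewrite lee_fin -[leLHS]expR0 ler_expR mulr_ge0 ?sqr_ge0// ltW.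
have -> : (\int[q]_theta (risk theta)%:E =
    \int[q]_theta (emp s theta)%:E + m%:E)%E.
  rewrite /m fineK; last exact: integrable_fin_num.
  rewrite -integralD//.
  - by apply: eq_integral => theta _; rewrite -EFinD /dev addrC subrK.
  - by apply: iq => // theta; have /andP[? ?] := emp01 s theta; rewrite ger0_norm.
rewrite leeD2l// -/a.
(* For an infinite divergence the right-hand side is [+oo]; the value [-oo] is excluded by [Wge]. *)
case: (KL q p + (ln b)%:E)%E Wge => [w| |]//=; last first.
  by move=> _; rewrite gt0_mulye ?lte_fin ?invr_gt0//= leey.
rewrite !lee_fin => amw.
apply: (le_trans (ler_norm m)); rewrite -sqrtr_sqr ler_wsqrtr//.
by rewrite ler_pdivlMr// mulrC.
Qed.

End pac_bayes.

(** * Entropy and the regularized objective *)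

Section entropy.
Variable R : realType.

(** Each probability is at most [1], so its logarithm is nonpositive. Nonnegativity lets
    [measurable_Rintegral_param] apply to the layer entropies. *)
Lemma shannon_entropy_ge0 (C : finType) (u : C -> R) :
  (forall c, 0 <= u c) -> \sum_c u c = 1 -> 0 <= shannon_entropy u.
Proof.
move=> u0 u1; rewrite oppr_ge0 sumr_le0// => c _.
rewrite mulr_ge0_le0// ln_le0// -u1 (bigD1 c)//= lerDl.
by rewrite sumr_ge0.
Qed.

Lemma measurable_shannon_entropy d (T : measurableType d) (C : finType) (u : T -> C -> R) :
  (forall c, measurable_fun setT (u ^~ c)) ->
  measurable_fun setT (fun x => shannon_entropy (u x)).
Proof.
move=> mu; apply: measurable_funN; apply: measurable_sum => c.
by apply: measurable_funM => //; apply: measurableT_comp.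
Qed.

End entropy.

(** The posterior is an arbitrary function [q] of the sample, so the set where the bound holds need
    not be measurable; the probability statement is carried by a measurable event [E] inside it. *)
Theorem theorem4p4
  (R : realType) (dX dY : measure_display)
  (X : measurableType dX) (Y : measurableType dY)
  (k L n : nat) (hn : (2 <= n)%N)
  (O : Type) (C : finType)
  (D : probability (X * Y)%type R)
  (f : params R k -> X -> O)
  (head : 'I_L -> params R k -> X -> C -> R)
  (head_ge0 : forall l theta x c, 0 <= head l theta x c)
  (head_sum1 : forall l theta x, \sum_c head l theta x c = 1)
  (head_meas : forall l c,
     measurable_fun [set: params R k * X] (fun w => head l w.1 w.2 c))
  (loss : O -> Y -> R)
  (loss01 : forall o y, 0 <= loss o y <= 1)
  (loss_meas :
     measurable_fun [set: params R k * (X * Y)]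
       (fun w => loss (f w.1 w.2.1) w.2.2))
  (Hstar : 'I_L -> R)
  (lambda : R) (lambda_ge0 : 0 <= lambda)
  (delta : R) (delta01 : 0 < delta < 1)
  (p : probability (params R k) R)
  (q : n.-tuple (X * Y)%type -> probability (params R k) R)
  (q_ac : forall s, q s `<< p) :
  (exists E : set (n.-tuple (X * Y)%type),
    [/\ measurable E,
        ((1 - delta)%:E <= power_measure D n E)%E
      & forall s, E s ->
        (\int[q s]_theta (objective D f head loss Hstar lambda theta)%:E
         <= \int[q s]_theta (emp_objective s f head loss Hstar lambda theta)%:E
          + sqrte ((KL (q s) p + (ln (2 * Num.sqrt n%:R / delta))%:E)
                   * ((2 * (n%:R - 1))^-1)%:E)
          + lambda%:E * \int[q s]_theta (Delta D head Hstar theta)%:E)%E])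
  /\
  (forall (s : n.-tuple (X * Y)%type)
      (theta_prev theta_bar : 'cV[R]_k) (Sigma_p Sigma_q : 'M[R]_k),
    is_gaussian p theta_prev Sigma_p ->
    is_gaussian (q s) theta_bar Sigma_q ->
    has_mean (q s) theta_bar ->
    has_covariance (q s) Sigma_q ->
    let kappa := lambda_max (invmx Sigma_p) in
    let Ct := 2^-1 * (\tr (invmx Sigma_p *m Sigma_q) - k%:R
                      + ln (\det Sigma_p / \det Sigma_q)) in
    (KL (q s) p
     <= (kappa / 2 * euclid_norm (theta_bar - theta_prev) ^+ 2 + Ct)%:E)%E).

Proof.
split; last first.
  move=> s mp mq Sp Sq pG qG qm qS /=.
  rewrite (gaussian_KL (q_ac s) pG qG qm qS) lee_fin.
  have Sp_sym : (invmx Sp)^T = invmx Sp by rewrite trmx_inv pG.1.1.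
  have := quad_form_le_lambda_max (mq - mp) Sp_sym; lra.
pose g (w : params R k * (X * Y)) := loss (f w.1 w.2.1) w.2.2.
have g01 w : 0 <= g w <= 1 by exact: loss01.
have [E [mE PE HE]] := pac_bayes D p loss_meas g01 hn delta01.
exists E; split => // s Es; have := HE s Es (q s) (q_ac s).
have ent0 l theta x : 0 <= shannon_entropy (head l theta x).
  exact: shannon_entropy_ge0 (head_ge0 l theta x) (head_sum1 l theta x).
have ment l : measurable_fun setT (fun w : params R k * X => shannon_entropy (head l w.1 w.2)).
  exact: measurable_shannon_entropy (head_meas l).
have mgtheta z : measurable_fun setT (fun theta => g (theta, z)).
  exact: (measurableT_comp loss_meas (measurable_pair2 z)).
have mrisk : measurable_fun setT (risk D f loss).
  apply: (measurable_Rintegral_param D loss_meas) => w.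
  by have /andP[] := g01 w.
have mlayer l : measurable_fun setT (layer_entropy D head l).
  apply: (measurable_Rintegral_param D (g := fun w => shannon_entropy (head l w.1 w.2.1))) => //.
  apply: (measurableT_comp
    (f := fun w : params R k * X => shannon_entropy (head l w.1 w.2))
    (g := fun w : params R k * (X * Y) => (w.1, w.2.1)) (ment l)).
  apply/measurable_fun_pairP; split; first exact: measurable_fst.
  exact: (measurableT_comp (f := @fst X Y) measurable_fst measurable_snd).
have mDelta : measurable_fun setT (Delta D head Hstar).
  apply: measurable_sum => l; apply: measurable_funX.
  exact: measurable_funB.
have memp : measurable_fun setT (emp_risk s f loss).
  apply: measurable_funM => //; apply: measurable_sum => i.
  exact: mgtheta.
have memplayer l : measurable_fun setT (emp_layer_entropy s head l).
  apply: measurable_funM => //; apply: measurable_sum => i.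
  exact: (measurableT_comp (ment l) (measurable_pair2 _)).
have mempDelta : measurable_fun setT (emp_Delta s head Hstar).
  apply: measurable_sum => l; apply: measurable_funX.
  exact: measurable_funB.
have Delta0 theta : 0 <= Delta D head Hstar theta.
  by apply: sumr_ge0 => l _; exact: sqr_ge0.
have empDelta0 theta : 0 <= emp_Delta s head Hstar theta.
  by apply: sumr_ge0 => l _; exact: sqr_ge0.
have risk0 theta : 0 <= risk D f loss theta.
  by apply: Rintegral_ge0 => z _; have /andP[] := g01 (theta, z).
have emp0 theta : 0 <= emp_risk s f loss theta.
  rewrite mulr_ge0 ?invr_ge0// sumr_ge0// => i _.
  by have /andP[] := g01 (theta, tnth s i).
move=> bound; rewrite /objective.
under eq_integral do rewrite EFinD EFinM.
(* Both summands are nonnegative since [lambda >= 0], so the integral splits even when the mean of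
   [Delta] is infinite. *)
rewrite ge0_integralD//; last 4 first.
- by move=> theta _; rewrite lee_fin.
- exact/measurable_EFinP.
- by move=> theta _; rewrite mule_ge0 ?lee_fin.
- by apply: measurable_funeM; exact/measurable_EFinP.
rewrite ge0_integralZl//; last 2 first.
- exact/measurable_EFinP.
- by move=> theta _; rewrite lee_fin.
(* The term in [Delta] now stands on both sides; what remains after [bound] is that the empirical
   risk is at most the empirical objective. *)
rewrite leeD2r//; apply: (le_trans bound); rewrite leeD2r//.
apply: ge0_le_integral => //.
- by move=> theta _; rewrite lee_fin; exact: emp0.
- exact/measurable_EFinP.
- apply/measurable_EFinP; apply: measurable_funD => //.
  exact: measurable_funM.
- by move=> theta _; rewrite lee_fin lerDl mulr_ge0.
Qed.
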